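(* Let $n\ge 1$ be an integer, let $\tilde n=4n-3$, and let $\mathbb{C}^n_0=\{\mathbf{x}=(x_0,\dots,x_{n-1})^T\in\mathbb{C}^n : x_0\in\mathbb{R}\}$. Let $\mathbf{F}=\mathbf{F}_{\tilde n}$ be the $\tilde n\times\tilde n$ unitary discrete Fourier transform matrix and let $\mathcal{S}_z:\mathbb{C}^n\to\mathbb{C}^{4n-3}$ be the zero-padded symmetrization $$\mathcal{S}_z(\mathbf{x})=(x_0,x_1,\dots,x_{n-1},\underbrace{0,\dots,0}_{2n-2},\overline{x_{n-1}},\dots,\overline{x_1})^T .$$ Then the $\tilde n$ absolute-square Fourier measurements $|\mathbf{F}\mathcal{S}_z(\mathbf{x})|^2$ are stable up to a global sign for $\mathbf{x}\in\mathbb{C}^n_0$; that is, for all $\mathbf{x}_1,\mathbf{x}_2\in\mathbb{C}^n_0$, $$\left\| |\mathbf{F}\mathcal{S}_z(\mathbf{x}_1)|^2-|\mathbf{F}\mathcal{S}_z(\mathbf{x}_2)|^2\right\|\ \ge\ c\,\left\|\mathcal{S}_z(\mathbf{x}_1-\mathbf{x}_2)\right\|\,\left\|\mathcal{S}_z(\mathbf{x}_1+\mathbf{x}_2)\right\|$$ with $c=c(\tilde n)=\alpha_{\tilde n}/\sqrt{\tilde n}>0$, where $\alpha_{\tilde n}>0$ is a lower norm-multiplicativity constant for zero-padded circular convolution in dimension $\tilde n$ (defined in the context).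
   Context: Vectors are indexed from $0$; $\|\cdot\|$ is the Euclidean ($\ell^2$) norm; for a vector $\mathbf{v}$, $|\mathbf{v}|^2$ is the vector of componentwise squared moduli $(|v_k|^2)_k$. The DFT matrix is $(\mathbf{F}_m)_{kl}=m^{-1/2}\exp(2\pi i\,kl/m)$ for $k,l\in\{0,\dots,m-1\}$ (it is unitary). The circular convolution of $\mathbf{u},\mathbf{v}\in\mathbb{C}^N$ is $(\mathbf{u}\circledast\mathbf{v})_k=\sum_{l=0}^{N-1}u_l v_{(k-l)\bmod N}$. The symmetrization $\mathcal{S}:\mathbb{C}^m\to\mathbb{C}^{2m-1}$ is $\mathcal{S}(\mathbf{y})=(y_0,\dots,y_{m-1},\overline{y_{m-1}},\dots,\overline{y_1})^T$, and $\mathcal{S}_z(\mathbf{x})=\mathcal{S}\big((\mathbf{x},\mathbf{0}_{n-1})\big)$, i.e. first append $n-1$ zeros to $\mathbf{x}\in\mathbb{C}^n$ to obtain a vector in $\mathbb{C}^{2n-1}$, then symmetrize. (This map is real-linear but not complex-linear.) For an integer $m\ge1$, $\alpha_m$ denotes a constant $\alpha_m>0$ such that $$\alpha_m\|\mathbf{u}\|\,\|\mathbf{v}\|\le\|(\mathbf{u},\mathbf{0})\circledast(\mathbf{v},\mathbf{0})\|\quad\text{for all }\mathbf{u},\mathbf{v}\in\mathbb{C}^m,$$ where $(\mathbf{u},\mathbf{0}),(\mathbf{v},\mathbf{0})\in\mathbb{C}^{2m-1}$ are the vectors padded by $m-1$ zeros and $\circledast$ is circular convolution in $\mathbb{C}^{2m-1}$.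 Such a positive constant, depending only on $m$, exists for every $m$ (a known earlier result). *)

(* Defs.v *)
From mathcomp Require Import all_boot all_order all_algebra zify.
From mathcomp Require Import reals trigo.
From mathcomp Require Export complex.

Set Implicit Arguments.
Unset Strict Implicit.
Unset Printing Implicit Defensive.

Import Order.TTheory GRing.Theory Num.Theory.
Local Open Scope ring_scope.
Local Open Scope complex_scope.

(* v_k for a natural number k, with the junk value 0 for k >= m. *)
Definition entry (C : nmodType) (m : nat) (v : 'cV[C]_m) (k : nat) : C :=
  if insub k is Some i then v i 0 else 0.

(* Meant for m <= N: the junk value 0 of [entry] supplies the padding. *)
Definition zpad (C : nmodType) (m N : nat) (v : 'cV[C]_m) : 'cV[C]_N :=
  \col_(k < N) entry v k.

(* As l < N, the natural number (k + (N - l)) %% N is (k - l) mod N. *)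
Definition cconv (C : pzSemiRingType) (N : nat) (u v : 'cV[C]_N) : 'cV[C]_N :=
  \col_(k < N) \sum_(l < N) u l 0 * entry v ((k + (N - l)) %% N).

Section Complex.
Variable R : realType.

Definition l2norm (m : nat) (v : 'cV[R[i]]_m) : R :=
  Num.sqrt (\sum_(k < m) Normc.normc (v k 0) ^+ 2).

(* The moduli `|_| are real elements of R[i], so that l2norm applies. *)
Definition abs2 (m : nat) (v : 'cV[R[i]]_m) : 'cV[R[i]]_m :=
  \col_k (`|v k 0| ^+ 2).

Definition expi (t : R) : R[i] := cos t +i* sin t.

Definition dft (m : nat) : 'M[R[i]]_m :=
  \matrix_(k, l) ((Num.sqrt m%:R)^-1%:C
                  * expi (2 * pi * (k * l)%N%:R / m%:R)).

(* (y_0, ..., y_(m-1), conj y_(m-1), ..., conj y_1) *)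
Definition symm (m : nat) (y : 'cV[R[i]]_m) : 'cV[R[i]]_(2 * m - 1) :=
  \col_(k < 2 * m - 1)
    if (k < m)%N then entry y k else (entry y (2 * m - 1 - k))^*.

(* (x_0, ..., x_(n-1), 0, ..., 0, conj x_(n-1), ..., conj x_1), with 2n-2
   zeros; zsymmE identifies it with the symmetrization of x padded by n-1
   zeros, whose dimension 2 * (2 * n - 1) - 1 is not convertible to 4 * n - 3. *)
Definition zsymm (n : nat) (x : 'cV[R[i]]_n) : 'cV[R[i]]_(4 * n - 3) :=
  \col_(k < 4 * n - 3)
    if (k < n)%N then entry x k
    else if (k < n + (2 * n - 2))%N then 0
    else (entry x (4 * n - 3 - k))^*.

Lemma entry_out (C : nmodType) (m : nat) (v : 'cV[C]_m) (k : nat) :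
  (m <= k)%N -> entry v k = 0.
Proof. by move=> le_mk; rewrite /entry insubN // -leqNgt. Qed.

Lemma entry_col (C : nmodType) (m : nat) (f : nat -> C) (k : nat) :
  entry (\col_(i < m) f i) k = if (k < m)%N then f k else 0.
Proof.
by rewrite /entry; case: insubP => [i -> <-|/negbTE ->//]; rewrite mxE.
Qed.

Lemma zsymmE (n : nat) (x : 'cV[R[i]]_n) (k : nat) : (0 < n)%N ->
  entry (zsymm x) k = entry (symm (zpad (2 * n - 1) x)) k.
Proof.
move=> n_gt0.
have pE j : entry (zpad (2 * n - 1) x) j = entry x j.
  rewrite /zpad (entry_col _ (entry x)); case: ltnP => // le_j.
  by rewrite entry_out //; lia.
rewrite /zsymm /symm (entry_col _ (fun k => if (k < n)%N then entry x k
  else if (k < n + (2 * n - 2))%N then 0 else (entry x (4 * n - 3 - k))^*)).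
rewrite (entry_col _ (fun k => if (k < 2 * n - 1)%N
  then entry (zpad (2 * n - 1) x) k
  else (entry (zpad (2 * n - 1) x) (2 * (2 * n - 1) - 1 - k))^*)) !pE.
have -> : (2 * (2 * n - 1) - 1 = 4 * n - 3)%N by lia.
case: (ltnP k (4 * n - 3)) => // lt_k.
case: (ltnP k n) => lt_kn; case: (ltnP k (2 * n - 1)) => lt_k2;
  case: (ltnP k (n + (2 * n - 2))) => lt_k3 //; try lia.
- by rewrite entry_out.
- by rewrite entry_out ?conjc0 //; lia.
Qed.

(* C^n_0 *)
Definition real_first (n : nat) (x : 'cV[R[i]]_n) : Prop :=
  entry x 0 \is Num.real.

Definition lower_conv_const (m : nat) (alpha : R) : Prop :=
  0 < alpha /\
  forall u v : 'cV[R[i]]_m,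
    alpha * l2norm u * l2norm v
      <= l2norm (cconv (zpad (2 * m - 1) u) (zpad (2 * m - 1) v)).

End Complex.

Arguments dft : clear implicits.

(* Main.v *)
(* Symmetrized vectors have real Fourier transforms, so with z_i = S_z(x_i) the
   measurements satisfy |F z_1|^2 - |F z_2|^2 = F(z_1 - z_2) . F(z_1 + z_2)
   entrywise.  A cyclic shift makes S_z(x) the coefficient vector of a polynomial
   of degree at most 2n - 2 and multiplies its transform by unimodular factors;
   the product of two such polynomials has degree at most 4n - 4, so by Parseval
   at the (4n - 3)-th roots of unity the norm of the left-hand side is the norm
   of the aperiodic convolution divided by sqrt(4n - 3).

   The constant alpha_m exists because a polynomial of degree less than m cannot
   be small, relative to its coefficients, at m distinct points: among 2m - 1
   points in the unit disk, two polynomials are large at a common one. *)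
Require Import Defs.
From mathcomp Require Import all_boot all_order all_algebra.
From mathcomp Require Import reals trigo.
From mathcomp Require Import zify ring lra.

Set Implicit Arguments.
Unset Strict Implicit.
Unset Printing Implicit Defensive.

Import Order.TTheory GRing.Theory Num.Theory.
Local Open Scope ring_scope.

(** * Coefficients of a polynomial bounded by its values *)

Lemma card_ge_injective (T : finType) (A : {set T}) (m : nat) :
  (m <= #|A|)%N -> exists f : {ffun 'I_m -> T}, injective f /\ forall i, f i \in A.
Proof.
move=> le_mA; exists [ffun i => enum_val (widen_ord le_mA i)]; split=> [i j|i].
  by rewrite !ffunE => /enum_val_inj [] /ord_inj.
by rewrite ffunE enum_valP.
Qed.

Section CoefficientNorm.
Variable F : numFieldType.
Implicit Types p q : {poly F}.

Let invV {m} (a : 'I_m -> F) := invmx (Vandermonde m (\row_j a j)).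
Let invV_norm {m} (a : 'I_m -> F) : F := \sum_i \sum_j `|invV a j i|.

(** The coefficient row times the Vandermonde matrix of the points is the row of values; inverting
    it writes each coefficient as a combination of values. *)
Lemma sum_coef_le_values (m : nat) (a : 'I_m -> F) p (e : F) :
  injective a -> (size p <= m)%N -> (forall j, `|p.[a j]| <= e) ->
  \sum_(i < m) `|p`_i| <= invV_norm a * e.
Proof.
move=> a_inj le_pm le_e.
pose V := Vandermonde m (\row_j a j).
have uV : V \in unitmx.
  rewrite unitmxE det_Vandermonde unitfE; apply/prodf_neq0 => i _.
  apply/prodf_neq0 => j lt_ij; rewrite !mxE subr_eq0.
  by apply: contraTneq lt_ij => /a_inj ->; rewrite ltnn.
have pV : \row_(i < m) p`_i *m V = \row_j p.[a j].
  apply/rowP => j; rewrite !mxE (horner_coef_wide _ le_pm).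
  by apply: eq_bigr => i _; rewrite !mxE.
rewrite /invV_norm mulr_suml; apply: ler_sum => i _.
have -> : p`_i = \sum_j p.[a j] * invV a j i.
  transitivity ((\row_(i < m) p`_i) 0 i); first by rewrite mxE.
  rewrite -(mulmxK uV (\row__ _)) pV mxE; apply: eq_bigr => j _.
  by rewrite mxE.
apply: le_trans (ler_norm_sum _ _ _) _.
rewrite mulr_suml; apply: ler_sum => j _.
by rewrite normrM mulrC ler_wpM2l.
Qed.

(** At [m] distinct points violating the bound, the inverse Vandermonde matrix would make the
    coefficient sum smaller than itself. There are finitely many choices of points, so one constant
    serves every [p]. *)
Lemma few_small_values (m : nat) (T : finType) (t : T -> F) : (0 < m)%N ->
  injective t -> exists2 C : F, 0 < C & forall p, (size p <= m)%N ->
  (#|[set j | ~~ (\sum_(i < m) `|p`_i| <= C * `|p.[t j]|)%R]| < m)%N.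
Proof.
move=> m_gt0 t_inj.
have iV_ge0 (a : 'I_m -> F) : 0 <= invV_norm a.
  by apply: sumr_ge0 => i _; apply: sumr_ge0.
(* Terms with [f] not injective are merely nonnegative; the summand 1 makes [C] strictly exceed each
   single [invV_norm (t \o f)]. *)
pose C := 1 + \sum_(f : {ffun 'I_m -> T}) invV_norm (t \o f).
have C_gt0 : 0 < C by rewrite ltr_wpDr ?sumr_ge0.
exists C => // p le_pm; rewrite ltnNge; apply/negP.
move=> /card_ge_injective [f [f_inj fA]].
set s := \sum_(i < m) `|p`_i| in fA *.
have s_ge0 : 0 <= s by apply: sumr_ge0.
have lt_s i : C * `|p.[t (f i)]| < s.
  have := fA i; rewrite inE -real_ltNge ?ger0_real //.
  by rewrite mulr_ge0 // ltW.
have s_gt0 : 0 < s.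
  by apply: le_lt_trans (lt_s (Ordinal m_gt0)); rewrite mulr_ge0 // ltW.
have : s <= invV_norm (t \o f) * (s / C).
  apply: sum_coef_le_values (inj_comp t_inj f_inj) le_pm _ => j.
  by rewrite ler_pdivlMr // mulrC ltW //=; exact: lt_s.
rewrite mulrA ler_pdivlMr // mulrC ler_pM2r // /C (bigD1 f) //=.
by rewrite addrCA gerDl => /le_gtF; rewrite ltr_wpDr ?sumr_ge0.
Qed.

Lemma sum_coef_mul (m : nat) : (0 < m)%N -> exists2 C : F, 0 < C &
  forall p q, (size p <= m)%N -> (size q <= m)%N ->
  (\sum_(i < m) `|p`_i|) * (\sum_(i < m) `|q`_i|)
    <= C * \sum_(k < 2 * m - 1) `|(p * q)`_k|.
Proof.
(* The nodes are distinct and lie in the interval from 0 to 1, so the value of [p * q] at a node is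
   at most its coefficient sum. *)
move=> m_gt0; pose t (j : 'I_(2 * m - 1)) : F := j.+1%:R^-1.
have t_inj : injective t.
  move=> i j /invr_inj/eqP; rewrite eqr_nat eqSS => /eqP; exact: ord_inj.
have [C C_gt0 smallP] := few_small_values m_gt0 t_inj.
exists (C ^+ 2) => [|p q le_pm le_qm]; first exact: exprn_gt0.
set A := fun p : {poly F} =>
  [set j | ~~ (\sum_(i < m) `|p`_i| <= C * `|p.[t j]|)].
(* Each factor is bad at no more than [m - 1] nodes, so one of the [2 * m - 1] nodes is good for
   both. *)
have [j] : exists j, j \notin A p :|: A q.
  apply/existsP; rewrite -negb_forall; apply/negP => /forallP allA.
  have : (#|A p :|: A q| = 2 * m - 1)%N.
    rewrite -[RHS]card_ord -cardsT; congr #|pred_of_set _|.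
    by apply/setP => j; rewrite [RHS]inE allA.
  have := (leq_card_setU (A p) (A q)).1; have := smallP p le_pm; have := smallP q le_qm.
  rewrite -/(A p) -/(A q); lia.
rewrite !inE negb_or !negbK => /andP[le_p le_q].
have sz : (size (p * q)%R <= 2 * m - 1)%N.
  by apply: leq_trans (size_polyMleq _ _) _; lia.
apply: le_trans (ler_pM _ _ le_p le_q) _; try exact: sumr_ge0.
rewrite mulrACA -expr2 ler_pM2l ?exprn_gt0 // -normrM -hornerM.
rewrite (horner_coef_wide _ sz); apply: le_trans (ler_norm_sum _ _ _) _.
apply: ler_sum => i _; rewrite normrM ler_piMr // normrX exprn_ile1 //.
by rewrite normfV normr_nat invf_le1 ?ltr0n // ler1n.
Qed.

End CoefficientNorm.

(** * Padded circular convolution as polynomial multiplication *)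

Definition colpoly (C : nzRingType) (m : nat) (v : 'cV[C]_m) : {poly C} :=
  \poly_(i < m) entry v i.

Lemma entry_ord (C : nmodType) (m : nat) (v : 'cV[C]_m) (i : 'I_m) :
  entry v i = v i 0.
Proof. by rewrite /entry valK. Qed.

Lemma coef_colpoly (C : nzRingType) (m : nat) (v : 'cV[C]_m) (i : nat) :
  (colpoly v)`_i = entry v i.
Proof. by rewrite coef_poly; case: ltnP => // le_mi; rewrite entry_out. Qed.

(** Nothing wraps around: for [l > k], either [l >= m] or the wrapped index [k + (2 * m - 1 - l)] is
    at least [m], so one factor is a padding zero. *)
Lemma cconv_zpad (C : nzRingType) (m : nat) (u v : 'cV[C]_m) k :
  cconv (zpad (2 * m - 1) u) (zpad (2 * m - 1) v) k 0
    = (colpoly u * colpoly v)`_k.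
Proof.
rewrite mxE coefM (big_ord_widen (2 * m - 1)%N
  (fun j => (colpoly u)`_j * (colpoly v)`_(k - j)%N)) // [RHS]big_mkcond /=.
apply: eq_bigr => l _.
have lt_l := ltn_ord l; have lt_k := ltn_ord k.
rewrite /zpad mxE (entry_col _ (entry v)) ltn_pmod ?coef_colpoly; last by lia.
have [le_lk|lt_kl] := leqP l k; rewrite ltnS ?le_lk ?(leqNgt l k) ?lt_kl /=.
  have -> : (k + (2 * m - 1 - l) = (k - l) + (2 * m - 1))%N by lia.
  by rewrite modnDr modn_small //; lia.
rewrite modn_small; last by lia.
have [lt_lm|le_ml] := ltnP l m; last by rewrite entry_out ?mul0r.
by rewrite [X in _ * X]entry_out ?mulr0 //; lia.
Qed.

(** * Euclidean norms and the existence of the convolution constant *)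

Section EuclideanNorm.
Local Open Scope complex_scope.
Variable R : realType.

Lemma l2norm_ge0 (m : nat) (v : 'cV[R[i]]_m) : 0 <= l2norm v.
Proof. exact: sqrtr_ge0. Qed.

Lemma sqr_l2norm (m : nat) (v : 'cV[R[i]]_m) :
  (l2norm v)%:C ^+ 2 = \sum_k `|v k 0| ^+ 2.
Proof.
rewrite -[LHS]rmorphXn /l2norm sqr_sqrtr; last by apply: sumr_ge0 => k _; exact: sqr_ge0.
by rewrite rmorph_sum; apply: eq_bigr => k _; rewrite rmorphXn.
Qed.

Lemma l2norm_scale (m m' : nat) (v : 'cV[R[i]]_m) (v' : 'cV[R[i]]_m') (c : R) :
  0 <= c ->
  \sum_k `|v k 0| ^+ 2 = c%:C ^+ 2 * \sum_k `|v' k 0| ^+ 2 ->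
  l2norm v = c * l2norm v'.
Proof.
move=> c_ge0; rewrite -!sqr_l2norm -exprMn => /eqP.
rewrite -[c%:C * _]rmorphM eqrXn2 ?ler0c ?mulr_ge0 ?l2norm_ge0 // => /eqP.
exact: complexI.
Qed.

Lemma normr_le_l2norm (m : nat) (v : 'cV[R[i]]_m) k :
  `|v k 0| <= (l2norm v)%:C.
Proof.
rewrite -(@ler_pXn2r _ 2) ?nnegrE // ?ler0c ?l2norm_ge0 //.
rewrite sqr_l2norm (bigD1 k) //= lerDl.
by apply: sumr_ge0 => i _; rewrite exprn_ge0.
Qed.

Lemma l2norm_le_sum (m : nat) (v : 'cV[R[i]]_m) :
  (l2norm v)%:C <= \sum_k `|v k 0|.
Proof.
rewrite -(@ler_pXn2r _ 2) ?nnegrE ?sumr_ge0 ?ler0c ?l2norm_ge0 //.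
rewrite sqr_l2norm expr2 mulr_suml; apply: ler_sum => k _.
by rewrite expr2 ler_wpM2l // (bigD1 k) //= lerDl sumr_ge0.
Qed.

(** The bound of [sum_coef_mul] passes to Euclidean norms: these are at most the coefficient sums of
    the factors, while the sum of the [2 * m - 1] moduli of the convolution is at most [2 * m - 1]
    times its norm. *)
Lemma lower_conv_const_exists (m : nat) : (0 < m)%N ->
  exists alpha : R, lower_conv_const m alpha.
Proof.
move=> m_gt0; have [C C_gt0 le_mul] := @sum_coef_mul R[i] m m_gt0.
have K_gt0 : 0 < C * (2 * m - 1)%:R by rewrite mulr_gt0 // ltr0n; lia.
(* [C] lives in [R[i]]; being positive it is real, and so is the constant. *)
have [alpha defK] : exists alpha : R, (C * (2 * m - 1)%:R)^-1 = alpha%:C.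
  by apply/complex_realP; rewrite gtr0_real ?invr_gt0.
exists alpha; split=> [|u v]; first by rewrite -ltcR -defK invr_gt0.
have realM (a b : R) : (a * b)%:C = a%:C * b%:C by exact: rmorphM.
rewrite -lecR !realM -defK -mulrA mulrC ler_pdivrMr //.
have l1E (w : 'cV[R[i]]_m) : \sum_(i < m) `|(colpoly w)`_i| = \sum_i `|w i 0|.
  by apply: eq_bigr => i _; rewrite coef_colpoly entry_ord.
have le_u := l2norm_le_sum u; have le_v := l2norm_le_sum v.
apply: le_trans (ler_pM _ _ le_u le_v) _; rewrite ?ler0c ?l2norm_ge0 //.
rewrite -!l1E; apply: le_trans (le_mul _ _ _ _) _; rewrite ?size_poly //.
rewrite [leRHS]mulrCA ler_pM2l //.
rewrite mulr_natr -[X in _ *+ X]card_ord -sumr_const; apply: ler_sum => k _.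
by rewrite -cconv_zpad; exact: normr_le_l2norm.
Qed.

End EuclideanNorm.

(** * Sums over residues under translation and negation *)

Section CyclicSums.
Variable V : nmodType.

Lemma sum_rot (N a : nat) (f : nat -> V) :
  \sum_(l < N) f ((l + a) %% N)%N = \sum_(l < N) f l.
Proof.
case: N => [|N]; first by rewrite !big_ord0.
rewrite [RHS](reindex_inj (addIr (inZp a : 'I_N.+1))).
by apply: eq_bigr => l _ /=; rewrite modnDmr.
Qed.

Lemma sum_opp (N : nat) (f : nat -> V) :
  \sum_(l < N) f ((N - l) %% N)%N = \sum_(l < N) f l.
Proof.
case: N => [|N]; first by rewrite !big_ord0.
by rewrite [RHS](reindex_inj oppr_inj).
Qed.

End CyclicSums.

(** * Roots of unity, Parseval and the discrete Fourier transform *)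

Section Fourier.
Local Open Scope complex_scope.
Variable R : realType.

Lemma expiD (s t : R) : expi (s + t) = expi s * expi t.
Proof. by rewrite /expi cosD sinD; simpc; congr (_ +i* _); rewrite addrC. Qed.

Lemma expiMn (t : R) (n : nat) : expi (t *+ n) = expi t ^+ n.
Proof.
elim: n => [|n IHn]; first by rewrite /expi mulr0n cos0 sin0.
by rewrite mulrSr expiD IHn exprSr.
Qed.

Lemma expi_conj (t : R) : expi t * (expi t)^* = 1.
Proof.
rewrite /expi; simpc; rewrite -!expr2 cos2Dsin2 mulrC addNr.
by [].
Qed.

Lemma norm_expi (t : R) : `|expi t| = 1.
Proof.
by apply/eqP; rewrite -(@eqrXn2 _ 2) // sqr_normc expi_conj expr1n.
Qed.

Lemma expi_neq1 (t : R) : 0 < t < 2 * pi -> expi t != 1.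
Proof.
move=> /andP[t_gt0 t_lt]; apply/eqP => -[cos1 _].
(* By the double-angle formula, [cos t = 1] would force [sin (t / 2) = 0]. *)
have : 0 < sin (t / 2) by apply: sin_gt0_pi; apply/andP; split; lra.
have := cos2Dsin2 (t / 2); have := cos_mulr2n (t / 2).
have -> : t / 2 *+ 2 = t by field.
rewrite cos1; nra.
Qed.

Definition omega (N : nat) : R[i] := expi (2 * pi / N%:R).

Lemma omegaX (N k : nat) : omega N ^+ k = expi (2 * pi * k%:R / N%:R).
Proof. by rewrite /omega -expiMn; congr expi; rewrite -[LHS]mulr_natr mulrAC. Qed.

Lemma omega_unity (N : nat) : (0 < N)%N -> omega N ^+ N = 1.
Proof.
move=> N_gt0; rewrite omegaX mulfK ?pnatr_eq0 ?gtn_eqF //.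
by rewrite mulr_natl /expi cos2pi sin2pi.
Qed.

Lemma omegaX_neq1 (N d : nat) : (0 < d < N)%N -> omega N ^+ d != 1.
Proof.
move=> /andP[d_gt0 lt_dN]; rewrite omegaX expi_neq1 //.
have N_gt0 : 0 < N%:R :> R by rewrite ltr0n; lia.
have pi2_gt0 : 0 < 2 * pi :> R by rewrite mulr_gt0 ?pi_gt0.
apply/andP; split; first by apply: divr_gt0 => //; apply: mulr_gt0; rewrite ?ltr0n.
by rewrite ltr_pdivrMr // ltr_pM2l // ltr_nat.
Qed.

Lemma omega_mod (N k : nat) : (0 < N)%N -> omega N ^+ (k %% N) = omega N ^+ k.
Proof. by move=> N_gt0; apply: expr_mod; exact: omega_unity. Qed.

Lemma omegaX_conj (N k : nat) : omega N ^+ k * (omega N ^+ k)^* = 1.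
Proof. by rewrite omegaX expi_conj. Qed.

Lemma sum_omega (N a b : nat) : (a < N)%N -> (b < N)%N ->
  \sum_(k < N) (omega N ^+ k) ^+ a * ((omega N ^+ k) ^+ b)^*
    = N%:R * (a == b)%:R.
Proof.
move=> lt_aN lt_bN; have N_gt0 : (0 < N)%N by lia.
pose z := omega N ^+ a * (omega N ^+ b)^*.
have -> : \sum_(k < N) (omega N ^+ k) ^+ a * ((omega N ^+ k) ^+ b)^* =
    \sum_(k < N) z ^+ k.
  by apply: eq_bigr => k _; rewrite exprMn -rmorphXn -!exprM ![(k * _)%N]mulnC.
have [eq_ab|neq_ab] := eqVneq a b.
  rewrite /z -eq_ab omegaX_conj; under eq_bigr do rewrite expr1n.
  by rewrite sumr_const card_ord mulr1.
(* Geometric sum: [z - 1] times it is [z ^+ N - 1 = 0]. It remains to see that [z] is not 1. *)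
rewrite mulr0; apply: (mulfI (x := z - 1)); last first.
  rewrite mulr0 -subrX1 /z exprMn -rmorphXn -!exprM ![(_ * N)%N]mulnC.
  by rewrite !exprM omega_unity // !expr1n rmorph1 mulr1 subrr.
rewrite subr_eq0; apply/eqP => z1.
have ab : omega N ^+ a = omega N ^+ b.
  by rewrite -[RHS]mul1r -z1 /z -mulrA [_^* * _]mulrC omegaX_conj mulr1.
have gen c d : (c < d < N)%N -> omega N ^+ c != omega N ^+ d.
  move=> lt_cd; apply: contraNneq (@omegaX_neq1 N (d - c) _); last by lia.
  move=> cd; have nz : omega N ^+ c != 0.
    by apply/eqP => c0; have /eqP := omegaX_conj N c; rewrite c0 mul0r eq_sym oner_eq0.
  by rewrite -(inj_eq (mulIf nz)) mul1r -exprD subnK ?cd //; lia.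
case: (ltngtP a b) neq_ab => // lt_ab _.
  by have := gen a b; rewrite ab eqxx lt_ab lt_bN => /(_ isT).
by have := gen b a; rewrite ab eqxx lt_ab lt_aN => /(_ isT).
Qed.

(** Expanding the squared modulus, orthogonality removes the off-diagonal terms; the size bound
    keeps distinct exponents distinct modulo [N]. *)
Lemma poly_parseval (N : nat) (Q : {poly R[i]}) : (size Q <= N)%N ->
  \sum_(k < N) `|Q.[omega N ^+ k]| ^+ 2 = N%:R * \sum_(j < N) `|Q`_j| ^+ 2.
Proof.
move=> leQN.
transitivity (\sum_(k < N) \sum_(a < N) \sum_(b < N) Q`_a * (Q`_b)^* *
  ((omega N ^+ k) ^+ a * ((omega N ^+ k) ^+ b)^*)).
  apply: eq_bigr => k _; rewrite sqr_normc (horner_coef_wide _ leQN) rmorph_sum.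
  rewrite mulr_suml; apply: eq_bigr => a _; rewrite mulr_sumr.
  by apply: eq_bigr => b _; rewrite rmorphM mulrACA.
rewrite exchange_big mulr_sumr; apply: eq_bigr => a _.
rewrite exchange_big (bigD1 a) //= -[RHS]addr0; congr (_ + _).
  by rewrite -mulr_sumr sum_omega // eqxx mulr1 sqr_normc mulrC.
rewrite big1 // => b /negbTE neq_ba.
by rewrite -mulr_sumr sum_omega // eq_sym val_eqE neq_ba !mulr0.
Qed.

Lemma dft_entry (N : nat) (y : 'cV[R[i]]_N) k :
  (dft R N *m y) k 0
    = (Num.sqrt N%:R)^-1%:C * \sum_(l < N) omega N ^+ (k * l) * entry y l.
Proof.
rewrite mxE mulr_sumr; apply: eq_bigr => l _.
by rewrite mxE entry_ord omegaX mulrA.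
Qed.

Lemma dft_real (N : nat) (y : 'cV[R[i]]_N) k :
  (forall l, (l < N)%N -> (entry y l)^* = entry y ((N - l) %% N)) ->
  (dft R N *m y) k 0 \is Num.real.
Proof.
move=> sym_y; have N_gt0 : (0 < N)%N := leq_ltn_trans (leq0n k) (ltn_ord k).
rewrite dft_entry rpredM //; first by apply/complex_realP; eexists.
set S := \sum_(l < N) _.
have Sconj : S^* = S.
  (* Conjugation sends the term of index [l] to that of index [N - l] modulo [N]. *)
  rewrite /S rmorph_sum -[RHS](sum_opp _ (fun l => omega N ^+ (k * l) * entry y l)).
  apply: eq_bigr => l _; rewrite rmorphM /= sym_y //; congr (_ * _).
  rewrite -[RHS]omega_mod // modnMmr omega_mod //.
  rewrite -[LHS]mulr1 -(expr1n _ k) -(@omega_unity N) // -exprM.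
  have -> : (N * k = k * l + k * (N - l))%N by have := ltn_ord l; nia.
  by rewrite exprD mulrA [_^* * _]mulrC omegaX_conj mul1r.
by apply/complex_realP; exists (complex.Re S); case: S Sconj => x y' [] /eqP;
  rewrite eqNr => /eqP ->.
Qed.

(** Shifting indices by [a] only changes the sum by the unimodular factor [omega N ^+ (k * a)]. *)
Lemma norm_dft_rot (N a : nat) (y : 'cV[R[i]]_N) k :
  `|(dft R N *m y) k 0| = (Num.sqrt N%:R)^-1%:C *
    `|(colpoly (\col_(j < N) entry y ((j + a) %% N))).[omega N ^+ k]|.
Proof.
have N_gt0 : (0 < N)%N := leq_ltn_trans (leq0n k) (ltn_ord k).
rewrite dft_entry normrM; congr (_ * _).
  by rewrite ger0_norm // ler0c invr_ge0 sqrtr_ge0.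
rewrite -(sum_rot _ a (fun l => omega N ^+ (k * l) * entry y l)).
rewrite -[RHS]mul1r.
have <- : `|omega N ^+ (k * a)| = 1 by rewrite omegaX norm_expi.
rewrite -normrM horner_poly mulr_sumr; congr `|_|; apply: eq_bigr => l _.
rewrite entry_ord mxE -omega_mod // modnMmr omega_mod //.
by rewrite mulnDr exprD exprM; ring.
Qed.

Lemma l2norm_rot (N a : nat) (y : 'cV[R[i]]_N) :
  l2norm (\col_(j < N) entry y ((j + a) %% N)) = l2norm y.
Proof.
rewrite -[RHS]mul1r; apply: l2norm_scale => //; rewrite expr1n mul1r.
under eq_bigr do rewrite mxE.
rewrite (sum_rot _ _ (fun l => `|entry y l| ^+ 2)).
by apply: eq_bigr => l _; rewrite entry_ord.
Qed.

End Fourier.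

(** * Measurements of symmetrized vectors *)

Section SymmetricMeasurements.
Local Open Scope complex_scope.
Variable R : realType.

Lemma l2norm_dft_mul (N a : nat) (y1 y2 d : 'cV[R[i]]_N) :
  let w1 := \col_(j < N) entry y1 ((j + a) %% N) in
  let w2 := \col_(j < N) entry y2 ((j + a) %% N) in
  (0 < N)%N -> (size (colpoly w1 * colpoly w2)%R <= N)%N ->
  (forall k, `|d k 0| = `|(dft R N *m y1) k 0| * `|(dft R N *m y2) k 0|) ->
  l2norm d = (Num.sqrt N%:R)^-1
    * l2norm (cconv (zpad (2 * N - 1) w1) (zpad (2 * N - 1) w2)).
Proof.
move=> w1 w2 N_gt0 leQN d_mul; set Q := (_ * _)%R in leQN.
apply: l2norm_scale; first by rewrite invr_ge0 sqrtr_ge0.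
set s : R[i] := _%:C.
have sN : s ^+ 2 * N%:R = 1.
  have -> : N%:R = N%:R%:C :> R[i] by rewrite rmorph_nat.
  rewrite -[s ^+ 2]rmorphXn -[LHS]rmorphM exprVn sqr_sqrtr ?ler0n //.
  by rewrite mulVf ?rmorph1 // pnatr_eq0 -lt0n.
(* Each transform contributes one [s], and squaring gives [s ^+ 4]; the factor [N] from Parseval
   then cancels [s ^+ 2]. *)
transitivity (\sum_(k < N) s ^+ 4 * `|Q.[omega R N ^+ k]| ^+ 2).
  apply: eq_bigr => k _.
  rewrite d_mul (norm_dft_rot a y1) (norm_dft_rot a y2) -/s -/w1 -/w2.
  by rewrite /Q hornerM normrM; ring.
rewrite -mulr_sumr poly_parseval // mulrA (exprD _ 2 2) -(mulrA (s ^+ 2)) sN mulr1.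
congr (_ * _); under [RHS]eq_bigr do rewrite cconv_zpad -/Q.
(* The coefficients of [Q] from index [N] on vanish, so the sum extends to the convolution
   length. *)
rewrite (big_ord_widen (2 * N - 1) (fun j => `|Q`_j| ^+ 2)); last by lia.
rewrite big_mkcond; apply: eq_bigr => j _; case: ltnP => // le_Nj.
by rewrite nth_default ?normr0 ?expr0n // (leq_trans leQN).
Qed.

Lemma entryD (m : nat) (u v : 'cV[R[i]]_m) (k : nat) :
  entry (u + v) k = entry u k + entry v k.
Proof. by rewrite /entry; case: insubP => [i _ _|_]; rewrite ?mxE ?addr0. Qed.

Lemma entryN (m : nat) (u : 'cV[R[i]]_m) (k : nat) :
  entry (- u) k = - entry u k.
Proof. by rewrite /entry; case: insubP => [i _ _|_]; rewrite ?mxE ?oppr0. Qed.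

Lemma entry_zsymm (n : nat) (x : 'cV[R[i]]_n) (k : nat) :
  entry (zsymm x) k =
    if (k < 4 * n - 3)%N then
      if (k < n)%N then entry x k
      else if (k < n + (2 * n - 2))%N then 0
      else (entry x (4 * n - 3 - k))^*
    else 0.
Proof.
exact: (entry_col _ (fun k => if (k < n)%N then entry x k
  else if (k < n + (2 * n - 2))%N then 0 else (entry x (4 * n - 3 - k))^*)).
Qed.

Lemma zsymmD (n : nat) (x y : 'cV[R[i]]_n) : zsymm (x + y) = zsymm x + zsymm y.
Proof.
apply/colP => k; rewrite !mxE !entryD; do 2?case: ifP => _ //.
  by rewrite addr0.
exact: rmorphD.
Qed.

Lemma zsymmN (n : nat) (x : 'cV[R[i]]_n) : zsymm (- x) = - zsymm x.
Proof.
apply/colP => k; rewrite !mxE !entryN; do 2?case: ifP => _ //.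
  by rewrite oppr0.
exact: rmorphN.
Qed.

Lemma zsymm_conj (n : nat) (x : 'cV[R[i]]_n) (l : nat) : real_first x ->
  (l < 4 * n - 3)%N ->
  (entry (zsymm x) l)^* = entry (zsymm x) ((4 * n - 3 - l) %% (4 * n - 3)).
Proof.
move=> x0_real lt_l; rewrite !entry_zsymm lt_l ltn_pmod; last by lia.
(* Index 0 is its own mirror image, so [x_0] has to equal its conjugate. *)
case: (posnP l) => [->|l_gt0].
  rewrite subn0 modnn; have -> : (0 < n)%N by lia.
  by have /complex_realP[r ->] := x0_real; rewrite conjc_real.
rewrite modn_small; last by lia.
case: (ltnP l n) => lt1.
  rewrite ifF ?ifF; try lia.
  by congr (entry _ _)^*; lia.
case: (ltnP l (n + (2 * n - 2))) => lt2.
  by case: ifP; last case: ifP; rewrite ?conjc0 //; lia.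
by rewrite conjcK ifT //; lia.
Qed.

(* The shift by [3 * n - 2 = -(n - 1)] modulo [4 * n - 3] centres the support of
   [zsymm x] at index [n - 1]. *)
Lemma size_zsymm_rot (n : nat) (x : 'cV[R[i]]_n) :
  (size (colpoly (\col_(j < 4 * n - 3)
     entry (zsymm x) ((j + (3 * n - 2)) %% (4 * n - 3)))) <= 2 * n - 1)%N.
Proof.
apply/leq_sizeP => j le_j; rewrite coef_colpoly.
rewrite (entry_col _ (fun j => entry (zsymm x) ((j + (3 * n - 2)) %% (4 * n - 3)))).
case: ltnP => // lt_j.
have -> : (j + (3 * n - 2) = (j - (n - 1)) + (4 * n - 3))%N by lia.
rewrite modnDr modn_small; last by lia.
by rewrite entry_zsymm; case: ifP => //; case: ifP; [lia|case: ifP => //; lia].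
Qed.

Lemma zsymm_measurements (n : nat) (x1 x2 : 'cV[R[i]]_n) k :
  real_first x1 -> real_first x2 ->
  `|(abs2 (dft R (4 * n - 3) *m zsymm x1)
     - abs2 (dft R (4 * n - 3) *m zsymm x2)) k 0|
  = `|(dft R (4 * n - 3) *m zsymm (x1 - x2)) k 0|
    * `|(dft R (4 * n - 3) *m zsymm (x1 + x2)) k 0|.
Proof.
move=> x1_real x2_real.
rewrite !zsymmD zsymmN mulmxBr mulmxDr.
have F1_real := dft_real k (fun l => zsymm_conj x1_real (l := l)).
have F2_real := dft_real k (fun l => zsymm_conj x2_real (l := l)).
move: (dft _ _ *m zsymm x1) (dft _ _ *m zsymm x2) F1_real F2_real => F1 F2 F1_real F2_real.
by rewrite -normrM !mxE !real_normK // subr_sqr.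
Qed.

End SymmetricMeasurements.

Theorem theorem2 (R : realType) (n : nat) (hn : (1 <= n)%N) :
  (exists alpha : R, lower_conv_const (4 * n - 3) alpha) /\
  (forall alpha : R, lower_conv_const (4 * n - 3) alpha ->
     let c := alpha / Num.sqrt (4 * n - 3)%:R in
     0 < c /\
     forall x1 x2 : 'cV[R[i]]_n, real_first x1 -> real_first x2 ->
       c * l2norm (zsymm (x1 - x2)) * l2norm (zsymm (x1 + x2))
       <= l2norm (abs2 (dft R (4 * n - 3) *m zsymm x1)
                  - abs2 (dft R (4 * n - 3) *m zsymm x2))).
Proof.
have N_gt0 : (0 < 4 * n - 3)%N by lia.
split; first exact: lower_conv_const_exists.
move=> alpha [alpha_gt0 le_conv] c.
split=> [|x1 x2 x1_real x2_real].
  by rewrite divr_gt0 // sqrtr_gt0 ltr0n.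
(* Two factors of size at most [2 * n - 1] have a product of size at most [4 * n - 3], exactly the
   transform length. *)
have le_size : (size (colpoly (\col_(j < 4 * n - 3)
      entry (zsymm (x1 - x2)%R) ((j + (3 * n - 2)) %% (4 * n - 3)))
    * colpoly (\col_(j < 4 * n - 3)
      entry (zsymm (x1 + x2)%R) ((j + (3 * n - 2)) %% (4 * n - 3))))%R
    <= 4 * n - 3)%N.
  apply: leq_trans (size_polyMleq _ _) _.
  by have := size_zsymm_rot (x1 - x2); have := size_zsymm_rot (x1 + x2); lia.
have measE k := zsymm_measurements k x1_real x2_real.
rewrite (l2norm_dft_mul N_gt0 le_size measE).
(* The convolution involves the rotated vectors, so the norms on the left are rotated to match. *)
rewrite /c -(l2norm_rot (3 * n - 2) (zsymm (x1 - x2))).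
rewrite -(l2norm_rot (3 * n - 2) (zsymm (x1 + x2))).
rewrite [alpha / _]mulrC -!mulrA ler_wpM2l ?invr_ge0 ?sqrtr_ge0 // mulrA.
exact: le_conv.
Qed.
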